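(* (Fluctuation-Dissipation Relation) Let $f:M\to M$ be a discrete map with an ergodic natural (hence $f$-invariant) probability measure $\mu$, and let $O:M\to\mathbb{R}$ be a measurable observable with $O\in L^2(\mu)$. Then for every integer $N\ge0$ the $O$-drift variance averaged over the natural distribution, $\langle\sigma_N^2\rangle=\int_M\sigma_N^2(x)\,d\mu(x)$, is related to the auto-correlation function $C_n(O,O)$ by $$\langle\sigma_N^2\rangle=\sum_{r=-N}^{N}\frac{(N-|r|)(N+1-|r|)(N+2-|r|)}{6(N+1)^2}\,C_r(O,O).$$
   Context: $f^n$ denotes the $n$-th iterate of the measurable map $f$. The natural measure is $\mu=\lim_{N\to\infty}\frac{1}{N+1}\sum_{n=0}^N\rho_0\circ f^{-n}$ for an initial probability measure $\rho_0$; it is $f$-invariant. Ergodic means that every measurable $A$ with $f^{-1}(A)=A$ has $\mu(A)\in\{0,1\}$. For $n\ge0$, $$C_n(O_1,O_2)=\int_M O_1(f^n(x))\,O_2(x)\,d\mu(x)-\left(\int_M O_1\,d\mu\right)\left(\int_M O_2\,d\mu\right),$$ and for negative index $C_{-r}(O,O)=C_r(O,O)$. The long-time average (existing for $\mu$-almost every $x$) is $$\bar O(x)=\lim_{N\to\infty}\frac{1}{N+1}\sum_{n=0}^N O(f^n(x)),$$ the $O$-drift is $$\Delta_N(x)=\sum_{n=0}^N\left[O(f^n(x))-\bar O(x)\right],$$ and the $O$-drift variance is $$\sigma_N^2(x)=\frac{1}{N+1}\sum_{n=0}^N\Delta_n^2(x)-\left(\frac{1}{N+1}\sum_{n=0}^N\Delta_n(x)\right)^2.$$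 *)

(* Defs.v *)
From HB Require Import structures.
From mathcomp Require Export all_boot all_order all_algebra.
From mathcomp Require Export all_classical all_reals all_analysis.

Set Implicit Arguments.
Unset Strict Implicit.
Unset Printing Implicit Defensive.

Import Order.TTheory GRing.Theory Num.Theory.
Import numFieldNormedType.Exports.

Local Open Scope classical_set_scope.
Local Open Scope ring_scope.

Section dynamics.
Context (R : realType) (d : measure_display) (M : measurableType d).
Implicit Types (f : M -> M) (mu : probability M R) (O : M -> R).

(* [mu] is the limit of the averaged push-forwards [rho0 \o f^{-n}] of some
   initial probability measure [rho0], the limit being taken on every
   measurable set (M carries no topology).  Every limit of this kind is
   f-invariant; conversely any f-invariant probability measure, and hence any
   invariant limit of these averages in a weaker sense, satisfies the predicate
   with [rho0 := mu]. *)
Definition natural_measure f mu : Prop :=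
  exists rho0 : probability M R, forall A : set M, measurable A ->
    ((N.+1%:R^-1)%:E * \sum_(0 <= n < N.+1) rho0 (iter n f @^-1` A))%E
      @[N --> \oo] --> mu A.

Definition ergodic f mu : Prop :=
  forall A : set M, measurable A -> f @^-1` A = A ->
    mu A = 0%E \/ mu A = 1%E.

Definition correlation f mu (n : nat) (O1 O2 : M -> R) : R :=
  Rintegral mu setT (fun x => O1 (iter n f x) * O2 x)
  - Rintegral mu setT O1 * Rintegral mu setT O2.

(* Extended to negative times by C_{-r}(O,O) = C_r(O,O). *)
Definition autocorrelation f mu (r : int) O : R := correlation f mu `|r|%N O O.

(* [limn] returns a junk value at the points where the averages diverge. *)
Definition time_average f O (x : M) : R :=
  limn (fun N => N.+1%:R^-1 * \sum_(0 <= n < N.+1) O (iter n f x)).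

Definition drift f O (N : nat) (x : M) : R :=
  \sum_(0 <= n < N.+1) (O (iter n f x) - time_average f O x).

Definition drift_variance f O (N : nat) (x : M) : R :=
  N.+1%:R^-1 * \sum_(0 <= n < N.+1) drift f O n x ^+ 2
  - (N.+1%:R^-1 * \sum_(0 <= n < N.+1) drift f O n x) ^+ 2.

End dynamics.

(* The integers -N, ..., N. *)
Definition symmetric_range (N : nat) : seq int :=
  [seq i%:Z - N%:Z | i <- iota 0 N.*2.+1].

(* Main.v *)
Require Import Defs.
From mathcomp Require Import measurable_realfun zify ring lra.

Set Implicit Arguments.
Unset Strict Implicit.
Unset Printing Implicit Defensive.

Import Order.TTheory GRing.Theory Num.Theory.
Import numFieldNormedType.Exports.
Local Open Scope classical_set_scope.
Local Open Scope ring_scope.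

(* A limit of averaged push-forwards is invariant, so by Birkhoff's theorem and
   ergodicity the time average of O is almost everywhere m := \int O.  Hence
   Delta_n is almost everywhere the Birkhoff sum S_(n+1) of Y := O - m, and
     (N+1)^2 sigma_N^2 = 1/2 \sum_(i, j <= N) (S_(i+1) - S_(j+1))^2.
   By invariance the integral of (S_i - S_j)^2 is V(|i-j|), where V(k) is the
   integral of S_k^2, and likewise V(k) = \sum_(i, j < k) C_|i-j|.  The averaged
   variance is therefore the Toeplitz sum of a Toeplitz sum of the correlations,
   and the cubic weights appear on collecting the terms of equal lag. *)

(** * Algebra of Toeplitz sums and of sums over symmetric lags *)

Section toeplitz.
Variable R : comNzRingType.
Implicit Types c h : nat -> R.

(* The index is |i - j|: one of the truncated differences is 0. *)
Definition toeplitz_sum c k : R :=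
  \sum_(i < k) \sum_(j < k) c ((i - j) + (j - i))%N.

(** The number of integers with absolute value [r]. *)
Definition lag_weight r : R := if r is 0%N then 1 else 2.

(** Enlarging the square adds a corner of lag 0, and a row and a column that each contain every lag
    from 1 to [k] once. *)
Lemma toeplitz_sumS c k :
  toeplitz_sum c k.+1 = toeplitz_sum c k + \sum_(r < k.+1) lag_weight r * c r.
Proof.
rewrite /toeplitz_sum big_ord_recr/=.
under eq_bigr do rewrite big_ord_recr/=.
rewrite big_split/= -addrA; congr (_ + _).
rewrite [X in _ + X]big_ord_recr/= subnn addn0 [RHS]big_ord_recl/= mul1r.
rewrite addrA addrC; congr (_ + _).
have back : \sum_(i < k) c (k - i)%N = \sum_(i < k) c i.+1.
  rewrite (reindex_inj rev_ord_inj)/=; apply: eq_bigr => i _; congr c.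
  by have := ltn_ord i; lia.
have lag1 : \sum_(i < k) c ((i - k) + (k - i))%N = \sum_(i < k) c (k - i)%N.
  by apply: eq_bigr => i _; congr c; have := ltn_ord i; lia.
have lag2 : \sum_(i < k) c ((k - i) + (i - k))%N = \sum_(i < k) c (k - i)%N.
  by apply: eq_bigr => i _; congr c; have := ltn_ord i; lia.
rewrite lag1 lag2 back -big_split/=.
by apply: eq_bigr => i _; rewrite /lag_weight /bump/=; ring.
Qed.

Lemma toeplitz_sum_lag c k :
  toeplitz_sum c k = \sum_(r < k) lag_weight r * (k%:R - r%:R) * c r.
Proof.
elim: k => [|k IH]; first by rewrite /toeplitz_sum !big_ord0.
rewrite toeplitz_sumS IH !big_ord_recr/= addrA -big_split/= -!natr1.
by congr (_ + _); [apply: eq_bigr => i _; ring|ring].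
Qed.

(** Discrete integration, done twice. With a = n - r, the step of a(a+1) is 2(a+1), which matches
    [toeplitz_sum_lag]; the step of a(a+1)(a+2) is 3(a+1)(a+2), which matches [toeplitz_sumS] for
    the outer sum, by [square]. *)
Lemma toeplitz_sum_cube c N :
  \sum_(r < N.+1) lag_weight r *
    ((N%:R - r%:R) * (N%:R + 1 - r%:R) * (N%:R + 2 - r%:R)) * c r =
  3 * toeplitz_sum (toeplitz_sum c) N.+1.
Proof.
pose V := toeplitz_sum c.
have V0 : V 0%N = 0 by rewrite /V /toeplitz_sum big_ord0.
have square n : \sum_(r < n.+1) lag_weight r *
    ((n%:R - r%:R) * (n%:R + 1 - r%:R)) * c r =
    \sum_(r < n.+1) lag_weight r * V r.
  elim: n => [|n IH]; first by rewrite !big_ord1/= V0; ring.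
  rewrite big_ord_recr/= [RHS]big_ord_recr/= -IH /V toeplitz_sum_lag.
  (* The new lag [n.+1] has weight zero, so both sides range over [r < n.+1]. *)
  rewrite subrr mul0r mulr0 mul0r addr0 mulr_sumr -big_split/= -!natr1.
  by apply: eq_bigr => i _; ring.
elim: N => [|N IH].
  by rewrite toeplitz_sumS !big_ord1 -/V V0 /toeplitz_sum big_ord0/=; ring.
rewrite toeplitz_sumS mulrDr -IH -/V -square [X in _ = _ + 3 * X]big_ord_recr/=.
rewrite big_ord_recr/= (mulrDr 3) [in RHS]mulr_sumr [in RHS]addrA.
rewrite -big_split/= -!natr1.
by congr (_ + _); [apply: eq_bigr => i _; ring|ring].
Qed.

Lemma symmetric_rangeS N :
  symmetric_range N.+1 = - N.+1%:Z :: rcons (symmetric_range N) N.+1%:Z.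
Proof.
rewrite /symmetric_range.
have -> : iota 0 N.+1.*2.+1 = 0%N :: rcons (map S (iota 0 N.*2.+1)) N.+1.*2.
  rewrite -cats1 -(iotaDl 1 0) -[[:: _]]/(iota (1 + N.*2.+1) 1) -iotaD addn1.
  by rewrite doubleS.
rewrite map_cons map_rcons -map_comp sub0r.
congr cons; congr rcons; last by lia.
by apply: eq_map => i /=; lia.
Qed.

Lemma sum_symmetric_range h N :
  \sum_(r <- symmetric_range N) h `|r|%N = \sum_(r < N.+1) lag_weight r * h r.
Proof.
elim: N => [|N IH]; first by rewrite big_seq1 big_ord1 /= mul1r.
rewrite symmetric_rangeS big_cons -cats1 big_cat big_seq1 IH/=.
by rewrite [RHS]big_ord_recr/=; ring.
Qed.

(** Writes an empirical variance through pairwise differences, in which any common mean cancels. *)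
Lemma sum_sqrB (x : nat -> R) n :
  \sum_(i < n) \sum_(j < n) (x i - x j) ^+ 2 =
  2 * (n%:R * \sum_(i < n) x i ^+ 2 - (\sum_(i < n) x i) ^+ 2).
Proof.
rewrite expr2 big_distrlr/=.
transitivity (\sum_(i < n) \sum_(j < n) (x i ^+ 2 + x j ^+ 2 - 2 * (x i * x j))).
  by apply: eq_bigr => i _; apply: eq_bigr => j _; ring.
under [LHS]eq_bigr do rewrite sumrB big_split/= sumr_const card_ord -mulr_sumr.
rewrite sumrB big_split/= -mulr_sumr sumr_const card_ord sumrMnl.
ring.
Qed.

End toeplitz.

(** * Measurability of pointwise limits *)

Lemma measurable_preimage_lt (R : realType) d (T : measurableType d)
    (h : T -> R) (a : R) :
  measurable_fun setT h -> measurable [set x | h x < a].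
Proof.
by move=> mh; rewrite -preimage_itvNyo -[X in measurable X]setTI; exact: mh.
Qed.

(** By completeness, convergence is the Cauchy criterion, and tolerances [k.+1%:R^-1] make it a
    countable combination of measurable sets. *)
Lemma measurable_cvgn (R : realType) d (T : measurableType d) (u : nat -> T -> R) :
  (forall n, measurable_fun setT (u n)) ->
  measurable [set x | cvgn (u ^~ x)].
Proof.
move=> mu_.
rewrite (_ : [set x | _] = \bigcap_k \bigcup_n \bigcap_(p in [set p | (n <= p)%N])
    \bigcap_(q in [set q | (n <= q)%N]) [set x | `|u p x - u q x| < k.+1%:R^-1]).
  apply: bigcapT_measurable => k; apply: bigcupT_measurable => n.
  apply: bigcap_measurable => [|p _]; first by exists n => /=.
  apply: bigcap_measurable => [|q _]; first by exists n => /=.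
  apply: measurable_preimage_lt.
  apply: measurableT_comp => //; exact: measurable_funB.
apply/seteqP; split => x /=.
  move=> /cauchy_cvgP/cauchy_ballP cx k _.
  have : 0 < k.+1%:R^-1 :> R by rewrite invr_gt0.
  move=> /cx; rewrite near_map2/= => -[[A B] /=[[a _ aA] [b _ bB]] AB].
  exists (maxn a b) => // p /= abp q /= abq.
  apply: (AB (p, q)); split => /=; [apply: aA|apply: bB]; rewrite /=; lia.
move=> cx; apply/cauchy_cvgP/cauchy_ballP => e e0; rewrite near_map2.
have [k _ /(_ k (leqnn k)) ke] := near_infty_natSinv_lt (PosNum e0).
have [n _ nx] := cx k I.
exists ([set m | (n <= m)%N], [set m | (n <= m)%N]) => /=; first by split; exists n.
move=> -[p q] /= [np nq]; apply: lt_trans ke; exact: nx.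
Qed.

(* Where the sequence diverges, [limn] is the constant [point]. *)
Lemma measurable_limn (R : realType) d (T : measurableType d) (u : nat -> T -> R) :
  (forall n, measurable_fun setT (u n)) ->
  measurable_fun setT (fun x => limn (u ^~ x)).
Proof.
move=> mu_; have mC := measurable_cvgn mu_.
rewrite -(setUv [set x | cvgn (u ^~ x)]).
apply/measurable_funU => //; first exact: measurableC.
split.
  apply: (@measurable_fun_cvg _ _ _ _ u) => [m|x ux].
    exact: measurable_funTS.
  exact: ux.
apply: (@eq_measurable_fun _ _ _ _ _ (cst point)) => //.
by move=> x /[!inE] ux; rewrite dvgP.
Qed.

(** * Invariance of the natural measure *)

Section invariant_measure.
Context (R : realType) (d : measure_display) (M : measurableType d).
Variables (f : M -> M) (mu : probability M R).
Hypothesis mf : measurable_fun [set: M] f.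

Lemma measurable_iter n : measurable_fun [set: M] (iter n f).
Proof.
elim: n => [|n IH]; first exact: measurable_id.
exact: (measurableT_comp mf IH).
Qed.

(** The averages for the preimage of [A] and for [A] differ by a telescoping sum, which is at most
    1/(N+1) in absolute value; limits are unique. *)
Lemma natural_measure_invariant : natural_measure f mu ->
  forall A, measurable A -> mu (f @^-1` A) = mu A.
Proof.
move=> [rho rho_mu] A mA.
have mfA : measurable (f @^-1` A) by rewrite -[X in measurable X]setTI; exact: mf.
have miter n B : measurable B -> measurable (iter n f @^-1` B).
  by move=> mB; rewrite -[X in measurable X]setTI; exact: measurable_iter.
pose r B n := fine (rho (iter n f @^-1` B)).
have rE B n : measurable B -> rho (iter n f @^-1` B) = (r B n)%:E.
  by move=> mB; rewrite /r fineK//; apply: fin_num_measure; exact: miter.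
have avg B : measurable B ->
    N.+1%:R^-1 * \sum_(0 <= n < N.+1) r B n @[N --> \oo] --> fine (mu B).
  move=> mB; have : ((N.+1%:R^-1)%:E * \sum_(0 <= n < N.+1) rho (iter n f @^-1` B))%E
      @[N --> \oo] --> (fine (mu B))%:E.
    by rewrite fineK ?fin_num_measure//; exact: rho_mu.
  move=> /fine_cvg; apply: cvg_trans; apply: near_eq_cvg; near=> N.
  rewrite /= (eq_bigr (fun n => (r B n)%:E)) => [|n _]; last exact: rE.
  by rewrite sumEFin.
rewrite -[LHS]fineK ?fin_num_measure// -[RHS]fineK ?fin_num_measure//.
congr EFin; apply/eqP; rewrite -subr_eq0; apply/eqP.
have r01 n : 0 <= r A n <= 1.
  rewrite -!lee_fin -rE// measure_ge0/=; apply: probability_le1; exact: miter.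
have diff0 : (N.+1%:R^-1 * \sum_(0 <= n < N.+1) r (f @^-1` A) n -
    N.+1%:R^-1 * \sum_(0 <= n < N.+1) r A n) @[N --> \oo] --> (0 : R).
  apply: norm_cvg0; apply: (@squeeze_cvgr _ _ _ _ (cst 0) (@harmonic R)).
  - apply: nearW => N /=; rewrite normr_ge0/= -mulrBr.
    rewrite [X in X - _](eq_bigr (fun n => r A n.+1)); last first.
      by [].
    rewrite -sumrB telescope_sumr// normrM ger0_norm ?invr_ge0//.
    rewrite ler_piMr ?invr_ge0// ler_norml.
    have /andP[? ?] := r01 0%N; have /andP[? ?] := r01 N.+1.
    by apply/andP; split; lra.
  - exact: cvg_cst.
  - exact: cvg_harmonic.
exact: (cvg_unique _ (cvgB (avg _ mfA) (avg _ mA)) diff0).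
Unshelve. all: by end_near.
Qed.
End invariant_measure.

(** * Birkhoff's theorem for an ergodic invariant probability measure *)

Section ergodic_theorem.
Context (R : realType) (d : measure_display) (M : measurableType d).
Variables (f : M -> M) (mu : probability M R).
Hypothesis mf : measurable_fun [set: M] f.
Hypothesis f_inv : forall A, measurable A -> mu (f @^-1` A) = mu A.
Implicit Types g h : M -> R.

Lemma ge0_integral_invariant (h : M -> \bar R) : measurable_fun setT h ->
  (forall x, (0 <= h x)%E) -> (\int[mu]_x h (f x) = \int[mu]_x h x)%E.
Proof.
move=> mh h0.
transitivity (\int[pushforward mu f]_y h y)%E.
  by rewrite ge0_integral_pushforward// => x _; exact: h0.
by apply: eq_measure_integral => A mA _; exact: f_inv.
Qed.

Lemma integrable_invariant h : mu.-integrable setT (EFin \o h) ->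
  mu.-integrable setT (EFin \o (h \o f)).
Proof.
move=> /integrableP[mh ih]; apply/integrableP; split.
  exact: (measurableT_comp mh mf).
by rewrite (ge0_integral_invariant (h := fun x => `|(EFin \o h) x|%E))//;
  exact: measurableT_comp.
Qed.

Lemma Rintegral_invariant h : mu.-integrable setT (EFin \o h) ->
  Rintegral mu setT (h \o f) = Rintegral mu setT h.
Proof.
move=> ih; congr fine.
transitivity (\int[pushforward mu f]_(y in setT) (EFin \o h) y)%E.
  rewrite integral_pushforward//; first by case/integrableP : ih.
  exact: integrable_invariant.
by apply: eq_measure_integral => A mA _; exact: f_inv.
Qed.

(** Indexed by its number of terms, whereas the drift of index [n] has [n.+1] terms. *)
Definition birkhoff_sum g n x := \sum_(0 <= i < n) g (iter i f x).

(* [birkhoff_max g n] is the maximum of the Birkhoff sums of length at most n. *)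
Fixpoint birkhoff_max g n : M -> R :=
  if n is m.+1 then (g \+ (birkhoff_max g m \o f))^\+%R else cst 0.

Lemma birkhoff_max_ge0 g n x : 0 <= birkhoff_max g n x.
Proof. by case: n => [|n] //=; rewrite /funrpos le_max lexx orbT. Qed.

Lemma birkhoff_max_ge g n x : g x + birkhoff_max g n (f x) <= birkhoff_max g n.+1 x.
Proof. by rewrite /= /funrpos le_max lexx. Qed.

Lemma birkhoff_max_leS g n x : birkhoff_max g n x <= birkhoff_max g n.+1 x.
Proof.
elim: n x => [|n IH] x; first exact: birkhoff_max_ge0.
have := birkhoff_max_ge g n.+1 x; have := birkhoff_max_ge0 g n.+2 x.
rewrite [birkhoff_max g n.+1 x]/= /funrpos /= ge_max => -> /=.
by rewrite andbT; apply: le_trans; rewrite lerD2l IH.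
Qed.

Lemma birkhoff_max_le g n x :
  birkhoff_max g n.+1 x <= `|g x| + birkhoff_max g n (f x).
Proof.
rewrite /= /funrpos /= ge_max lerD2r ler_norm/=.
by rewrite addr_ge0// birkhoff_max_ge0.
Qed.

Lemma birkhoff_sum_le_max g n x : birkhoff_sum g n x <= birkhoff_max g n x.
Proof.
elim: n x => [|n IH] x; first by rewrite /birkhoff_sum big_geq.
apply: le_trans (birkhoff_max_ge g n x).
rewrite /birkhoff_sum big_nat_recl//= lerD2l; apply: le_trans (IH _).
by under eq_bigr do rewrite -iterS iterSr.
Qed.

Lemma integrable_birkhoff_max g n : mu.-integrable setT (EFin \o g) ->
  mu.-integrable setT (EFin \o birkhoff_max g n).
Proof.
move=> ig; elim: n => [|n IH]; first exact: integrable0.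
by apply: integrable_funrpos => //; exact: integrableD ig (integrable_invariant IH).
Qed.

(** As the maxima are nondecreasing in [n], this is where they tend to infinity. Natural thresholds
    keep the intersection countable. *)
Definition birkhoff_unbounded g : set M :=
  [set x | forall k : nat, exists n, k%:R < birkhoff_max g n x].

Lemma measurable_birkhoff_unbounded g : mu.-integrable setT (EFin \o g) ->
  measurable (birkhoff_unbounded g).
Proof.
move=> ig; rewrite (_ : birkhoff_unbounded g =
    \bigcap_k \bigcup_n (birkhoff_max g n @^-1` `]k%:R, +oo[)).
  apply: bigcapT_measurable => k; apply: bigcupT_measurable => n.
  rewrite -[X in measurable X]setTI.
  by have /integrableP[/measurable_EFinP mm _] := integrable_birkhoff_max n ig;
    exact: mm.
apply/seteqP; split => x /= ux k.
  by move=> _; have [n kn] := ux k; exists n => //=; rewrite in_itv/= kn.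
by have [n _] := ux k I; rewrite /= in_itv/= andbT => kn; exists n.
Qed.

(** Up to a shift of [n], the maxima at [x] and at [f x] differ by at most [|g x|]. Raising the
    threshold by an integer above [|g x|] absorbs this offset, and gives the exact equality that
    [ergodic] asks for. *)
Lemma birkhoff_unbounded_invariant g :
  f @^-1` birkhoff_unbounded g = birkhoff_unbounded g.
Proof.
have gx x := truncnS_gt `|g x|.
apply/seteqP; split => x ux k.
  have [n kn] := ux (k + (Num.truncn `|g x|).+1)%N; exists n.+1.
  apply: lt_le_trans (birkhoff_max_ge g n x).
  move: kn; rewrite natrD; have := gx x; have := lerNnormlW (lexx `|g x|).
  lra.
have [n kn] := ux (k + (Num.truncn `|g x|).+1)%N; exists n.
have := birkhoff_max_le g n x; have := birkhoff_max_leS g n x.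
by move: kn; rewrite natrD; have := gx x; lra.
Qed.

(* Katok--Hasselblatt: on the invariant set where the maxima are unbounded,
   [birkhoff_max g n.+1 - birkhoff_max g n \o f] is eventually [g], although
   its integral is nonnegative by invariance and monotonicity. *)
Lemma birkhoff_unbounded_null g : ergodic f mu ->
  mu.-integrable setT (EFin \o g) -> Rintegral mu setT g < 0 ->
  mu (birkhoff_unbounded g) = 0%E.
Proof.
move=> erg ig g_lt0.
have mE := measurable_birkhoff_unbounded ig.
have [//|E1] := erg _ mE (birkhoff_unbounded_invariant g).
exfalso; move: g_lt0; apply/negP; rewrite -leNgt.
pose D n x := birkhoff_max g n.+1 x - birkhoff_max g n (f x).
have iD n : mu.-integrable setT (EFin \o D n).
  have iS := integrable_birkhoff_max n.+1 ig.
  have if_ := integrable_invariant (integrable_birkhoff_max n ig).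
  exact: (integrableB measurableT iS if_).
have D_ge0 n : 0 <= Rintegral mu setT (D n).
  rewrite RintegralB//; last 2 first.
  - exact: integrable_birkhoff_max.
  - exact: integrable_invariant (integrable_birkhoff_max n ig).
  rewrite (Rintegral_invariant (integrable_birkhoff_max n ig)) subr_ge0.
  by apply: le_Rintegral => //;
    [exact: integrable_birkhoff_max|exact: integrable_birkhoff_max|
     move=> x _; exact: birkhoff_max_leS].
have mD n : measurable_fun setT (EFin \o D n) by case/integrableP : (iD n).
have mg : measurable_fun setT (EFin \o g) by case/integrableP : ig.
have D_g : {ae mu, forall x, setT x -> EFin \o D ^~ x @ \oo --> (EFin \o g) x}.
  exists (~` birkhoff_unbounded g); split.
  - exact: measurableC.
  - by rewrite probability_setC// E1 subee.
  apply: subsetC => x Ux _.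
  (* By invariance the maxima at [f x] eventually exceed [|g x|]; from then on the positive part in
     the recursion is inactive and [D n x] equals [g x]. *)
  have : (f @^-1` birkhoff_unbounded g) x by rewrite birkhoff_unbounded_invariant.
  move=> /(_ (Num.truncn `|g x|).+1) [m gm].
  apply: cvg_near_cst; exists m => // n /= mn; congr EFin.
  have M_ndecr : birkhoff_max g m (f x) <= birkhoff_max g n (f x).
    have /nondecreasing_seqP : forall k, birkhoff_max g k (f x) <=
      birkhoff_max g k.+1 (f x) by move=> k; exact: birkhoff_max_leS.
    exact.
  rewrite /D /= /funrpos /= max_l; first by rewrite addrK.
  have := truncnS_gt `|g x|; have := lerNnormlW (lexx `|g x|); lra.
(* Subtracting a nonnegative maximum leaves [D n x] between [g x] and [|g x|], a bound uniform in
   [n]. *)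
have D_le : {ae mu, forall x n, setT x ->
    (`|(EFin \o D n) x| <= (EFin \o (Num.norm \o g)) x)%E}.
  apply: aeW => x n _; rewrite lee_fin /D /= /funrpos /=.
  rewrite ler_norml lerBrDr le_max lerD2r lerNnormlW//= lerBlDr ge_max.
  by rewrite lerD2r ler_norm/= addr_ge0// birkhoff_max_ge0.
have [_ _ cvg_int] := dominated_convergence measurableT mD mg D_g
  (integrable_norm ig) D_le.
apply: fine_ge0; apply: (cvge_to_ge cvg_int); apply: nearW => n /=.
rewrite -[leRHS]fineK ?lee_fin; first exact: D_ge0.
exact: integrable_fin_num (iD n).
Qed.

(** The function [g - c] has negative integral, so almost everywhere its Birkhoff maxima are
    bounded, by a [K] that depends on [x]. *)
Lemma birkhoff_sum_bounded g c : ergodic f mu ->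
  mu.-integrable setT (EFin \o g) -> Rintegral mu setT g < c ->
  {ae mu, forall x, exists K : R, forall n, birkhoff_sum g n x <= c * n%:R + K}.
Proof.
move=> erg ig gc.
have ic : mu.-integrable setT (EFin \o cst c).
  exact: finite_measure_integrable_cst.
pose h x := g x - c.
have ih : mu.-integrable setT (EFin \o h) by exact: (integrableB measurableT ig ic).
have h_lt0 : Rintegral mu setT h < 0.
  rewrite (RintegralB measurableT ig ic) [X in _ - X](_ : _ = c) ?subr_lt0//.
  rewrite Rintegral_cst// -[RHS]mulr1; congr (_ * _).
  exact: (congr1 fine (probability_setT mu)).
exists (birkhoff_unbounded h); split.
- exact: measurable_birkhoff_unbounded.
- exact: birkhoff_unbounded_null.
move=> x /=; apply: contra_notP => /existsNP[k /forallNP nk].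
exists k%:R => n; rewrite -lerBlDl.
have -> : birkhoff_sum g n x - c * n%:R = birkhoff_sum h n x.
  by rewrite /birkhoff_sum sumrB sumr_const_nat subn0 mulr_natr.
by apply: le_trans (birkhoff_sum_le_max h n x) _; rewrite leNgt; apply/negP.
Qed.

(** Linear bounds with slopes just above the mean, for [g] and for [- g], squeeze the averages,
    since [K] divided by [N.+1] vanishes. *)
Theorem birkhoff_ergodic g : ergodic f mu -> mu.-integrable setT (EFin \o g) ->
  {ae mu, forall x, N.+1%:R^-1 * \sum_(0 <= n < N.+1) g (iter n f x) @[N --> \oo]
    --> Rintegral mu setT g}.
Proof.
move=> erg ig; set m := Rintegral mu setT g.
have small (K e : R) : 0 < e -> \forall N \near \oo, K * N.+1%:R^-1 <= e.
  move=> e0; have : K * @harmonic R N @[N --> \oo] --> K * 0.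
    by apply: cvgMl_tmp; exact: cvg_harmonic.
  by rewrite mulr0 => /cvgr_le; apply.
have ub k : {ae mu, forall x, exists K : R, forall n,
    birkhoff_sum g n x <= (m + k.+1%:R^-1) * n%:R + K}.
  by apply: birkhoff_sum_bounded => //; rewrite ltrDl invr_gt0.
have lb k : {ae mu, forall x, exists K : R, forall n,
    birkhoff_sum (- g) n x <= (- m + k.+1%:R^-1) * n%:R + K}.
  apply: birkhoff_sum_bounded => //; first exact: integrableN ig.
  have := RintegralZl (-1) measurableT ig.
  under eq_Rintegral do rewrite mulN1r.
  by move=> ->; rewrite mulN1r ltrDl invr_gt0.
(* Countably many slopes suffice, so one null set serves for all tolerances. *)
have {}ub := ae_foralln ub; have {}lb := ae_foralln lb.
near=> x.
have ubx : forall k, exists K : R, forall n,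
  birkhoff_sum g n x <= (m + k.+1%:R^-1) * n%:R + K by near: x.
have lbx : forall k, exists K : R, forall n,
  birkhoff_sum (- g) n x <= (- m + k.+1%:R^-1) * n%:R + K by near: x.
apply/cvgrPdist_le => /= e e0; have e20 : 0 < e / 2 by rewrite divr_gt0.
have [k _ /(_ k (leqnn k))/= ke] := near_infty_natSinv_lt (PosNum e20).
have [K Kub] := ubx k; have [L Llb] := lbx k.
near=> N.
have KN : K * N.+1%:R^-1 <= e / 2 by near: N; exact: small.
have LN : L * N.+1%:R^-1 <= e / 2 by near: N; exact: small.
have N0 : 0 < N.+1%:R :> R by [].
have avg_le (h : M -> R) c J : birkhoff_sum h N.+1 x <= c * N.+1%:R + J ->
    N.+1%:R^-1 * birkhoff_sum h N.+1 x <= c + J * N.+1%:R^-1.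
  by move=> hc; rewrite mulrC ler_pdivrMr// mulrDl divfK// gt_eqF.
have := avg_le _ _ _ (Kub N.+1); have := avg_le _ _ _ (Llb N.+1).
rewrite {1}/birkhoff_sum sumrN mulrN -/(birkhoff_sum g N.+1 x).
rewrite -/(birkhoff_sum g N.+1 x) ler_norml.
move: KN LN ke.
move: (K / _) (L / _) (_ * birkhoff_sum _ _ _) (k.+1%:R^-1) => u v a w.
lra.
Unshelve. all: by end_near.
Qed.

End ergodic_theorem.

(** Integrability comes with the value so that the lemma can be applied again to the outer sum of a
    double sum. *)
Lemma Rintegral_sum (R : realType) d (T : measurableType d)
    (mu : {measure set T -> \bar R}) (I : Type) (s : seq I) (h : I -> T -> R) :
  (forall i, mu.-integrable setT (EFin \o h i)) ->
  mu.-integrable setT (EFin \o (fun x => \sum_(i <- s) h i x)) /\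
  Rintegral mu setT (fun x => \sum_(i <- s) h i x) =
    \sum_(i <- s) Rintegral mu setT (h i).
Proof.
move=> ih; elim: s => [|i s [IHi IHs]].
  rewrite (_ : (fun x => _) = cst 0); last by apply/funext => x; rewrite big_nil.
  by rewrite big_nil Rintegral_cst// mul0r; split => //; exact: integrable0.
rewrite (_ : (fun x => _) = fun x => h i x + \sum_(j <- s) h j x); last first.
  by apply/funext => x; rewrite big_cons.
split; last by rewrite big_cons RintegralD// IHs.
exact: (integrableD measurableT (ih i) IHi).
Qed.

(** * Second moments of Birkhoff sums in terms of correlations *)

Section correlations.
Context (R : realType) (d : measure_display) (M : measurableType d).
Variables (f : M -> M) (mu : probability M R).
Hypothesis mf : measurable_fun [set: M] f.
Hypothesis f_inv : forall A, measurable A -> mu (f @^-1` A) = mu A.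
Implicit Types g h : M -> R.

Lemma Rintegral_iter_invariant h n : mu.-integrable setT (EFin \o h) ->
  Rintegral mu setT (h \o iter n f) = Rintegral mu setT h.
Proof.
elim: n h => [//|n IH] h ih.
rewrite -(Rintegral_invariant mf f_inv ih) -(IH (h \o f))//.
exact: integrable_invariant.
Qed.

(** The p-norm is computed from the integral of a nonnegative function, which composition with [f]
    preserves. *)
Lemma Lfun_comp_iter h p n : h \in Lfun mu p%:E -> h \o iter n f \in Lfun mu p%:E.
Proof.
elim: n h => [//|n IH] h hL.
suff : h \o f \in Lfun mu p%:E by move/IH.
move: hL; rewrite !inE => /andP[] /[!inE]/= mh finh.
apply/andP; rewrite !inE/=; split; first exact: measurableT_comp mh mf.
move: finh; rewrite /finite_norm unlock.
rewrite (ge0_integral_invariant mf f_inv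
  (h := fun x => (`|(EFin \o h) x| `^ p)%E))//; last first.
  by move=> x; exact: poweR_ge0.
apply/measurable_EFinP/(measurableT_comp (measurable_powR _)) => //.
exact: measurableT_comp.
Qed.

Variable O : M -> R.
Hypothesis O_L2 : O \in Lfun mu 2%:E.
Let m := Rintegral mu setT O.
Let Y : M -> R := fun x => O x - m.

Let iO : mu.-integrable setT (EFin \o O).
Proof.
by apply/Lfun1_integrable; apply: Lfun_subset12 O_L2; rewrite fin_num_measure.
Qed.

Let L2B g h : g \in Lfun mu 2%:E -> h \in Lfun mu 2%:E ->
  g - h \in Lfun mu 2%:E.
Proof. by move=> gL hL; apply: rpredB => //; exact: lee1n. Qed.

Let Y_L2 : Y \in Lfun mu 2%:E.
Proof. exact: (L2B O_L2 (Lfun_cst mu m 2)). Qed.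

Let S n x := birkhoff_sum f Y n x.

Let S_L2 n : S n \in Lfun mu 2%:E.
Proof.
rewrite (_ : S n = \sum_(0 <= i < n) (Y \o iter i f)).
  by apply: rpred_sum => [|? i _]; [exact: lee1n|exact: Lfun_comp_iter].
by apply/funext => x; rewrite fct_sumE.
Qed.

Let integrable_L2M g h : g \in Lfun mu 2%:E -> h \in Lfun mu 2%:E ->
  mu.-integrable setT (EFin \o (fun x => g x * h x)).
Proof. by move=> gL hL; apply/Lfun1_integrable; exact: Lfun2_mul_Lfun1. Qed.

(** On expanding the product, invariance gives [O \o iter r f] the mean [m], so the terms other than
    the product of observables add up to [- (m * m)]. *)
Lemma correlation_centered r :
  correlation f mu r O O = Rintegral mu setT (fun x => Y (iter r f x) * Y x).
Proof.
have L2r := Lfun_comp_iter r O_L2.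
have ir : mu.-integrable setT (EFin \o (O \o iter r f)).
  by apply/Lfun1_integrable; apply: Lfun_subset12 L2r; rewrite fin_num_measure.
have icst : mu.-integrable setT (EFin \o cst (m * m)).
  exact: finite_measure_integrable_cst.
rewrite /correlation -/m.
have iOO := integrable_L2M L2r O_L2.
have iD : mu.-integrable setT (EFin \o (fun x => O (iter r f x) + O x)).
  exact: (integrableD measurableT ir iO).
have imD : mu.-integrable setT (EFin \o (fun x => m * (O (iter r f x) + O x))).
  exact: (integrableZl measurableT m iD).
have iB : mu.-integrable setT
    (EFin \o (fun x => O (iter r f x) * O x - m * (O (iter r f x) + O x))).
  exact: (integrableB measurableT iOO imD).
transitivity (Rintegral mu setT (fun x =>
    O (iter r f x) * O x - m * (O (iter r f x) + O x) + cst (m * m) x)); last first.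
  by apply: eq_Rintegral => x _; rewrite /Y/=; ring.
rewrite (RintegralD measurableT iB icst) (RintegralB measurableT iOO imD).
rewrite (RintegralZl m measurableT iD) (RintegralD measurableT ir iO).
rewrite (Rintegral_iter_invariant r iO) -/m Rintegral_cst//.
rewrite (_ : fine _ = 1); last exact: (congr1 fine (probability_setT mu)).
ring.
Qed.

Lemma Rintegral_birkhoff_sum_sqr k :
  Rintegral mu setT (fun x => S k x ^+ 2) =
  toeplitz_sum (fun r => correlation f mu r O O) k.
Proof.
have YY i j : mu.-integrable setT
    (EFin \o (fun x => Y (iter i f x) * Y (iter j f x))).
  exact: integrable_L2M (Lfun_comp_iter i Y_L2) (Lfun_comp_iter j Y_L2).
have E i j : Rintegral mu setT (fun x => Y (iter i f x) * Y (iter j f x)) =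
    correlation f mu ((i - j) + (j - i))%N O O.
  wlog ij : i j / (j <= i)%N.
    move=> W; have [/W//|/ltnW/W] := leqP j i.
    by rewrite addnC => <-; apply: eq_Rintegral => x _; rewrite mulrC.
  rewrite (eqP ij) addn0 correlation_centered.
  (* For [j <= i] the product at times [i] and [j] is the product at times [i - j] and 0, composed
     with [iter j f]. *)
  rewrite -(Rintegral_iter_invariant j (YY (i - j)%N 0%N)).
  by apply: eq_Rintegral => x _ /=; rewrite -iterD subnK.
rewrite /toeplitz_sum; transitivity (Rintegral mu setT (fun x =>
    \sum_(i < k) \sum_(j < k) Y (iter i f x) * Y (iter j f x))).
  apply: eq_Rintegral => x _.
  by rewrite /S /birkhoff_sum expr2 big_mkord big_distrlr.
have row (i : 'I_k) := Rintegral_sum (index_enum 'I_k) (fun j => YY i j).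
rewrite (Rintegral_sum _ (fun i => (row i).1)).2.
by apply: eq_bigr => i _; rewrite (row i).2; apply: eq_bigr => j _; exact: E.
Qed.

(** For [j <= i] the difference is [S (i - j)] composed with [iter j f], so invariance reduces it to
    [Rintegral_birkhoff_sum_sqr]. *)
Lemma Rintegral_birkhoff_sumB_sqr i j :
  mu.-integrable setT (EFin \o (fun x => (S i x - S j x) ^+ 2)) /\
  Rintegral mu setT (fun x => (S i x - S j x) ^+ 2) =
  toeplitz_sum (fun r => correlation f mu r O O) ((i - j) + (j - i)).
Proof.
split.
  exact: (integrable_L2M (L2B (S_L2 i) (S_L2 j)) (L2B (S_L2 i) (S_L2 j))).
wlog ij : i j / (j <= i)%N.
  move=> W; have [/W//|/ltnW/W] := leqP j i.
  rewrite addnC => <-; apply: eq_Rintegral => x _.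
  by rewrite -sqrrN opprB.
rewrite (eqP ij) addn0 -Rintegral_birkhoff_sum_sqr.
rewrite -(Rintegral_iter_invariant j (integrable_L2M (S_L2 (i - j)) (S_L2 (i - j)))).
apply: eq_Rintegral => x _ /=; rewrite -expr2; congr (_ ^+ 2).
rewrite /S /birkhoff_sum (big_cat_nat (n := j))//= [LHS]addrAC subrr add0r.
rewrite -{1}(add0n j) big_addn; apply: eq_bigr => k _.
by rewrite iterD.
Qed.

End correlations.

(** * The drift variance and its average *)

Lemma measurable_drift_variance (R : realType) (d : measure_display)
    (M : measurableType d) (f : M -> M) (O : M -> R) (N : nat) :
  measurable_fun setT f -> measurable_fun setT O ->
  measurable_fun setT (drift_variance f O N).
Proof.
move=> mf mO.
have mOf n : measurable_fun setT (fun x => O (iter n f x)).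
  exact: measurableT_comp mO (measurable_iter mf n).
have mavg : measurable_fun setT (time_average f O).
  apply: measurable_limn => n; apply: measurable_funM => //.
  exact: measurable_sum.
have mdrift n : measurable_fun setT (drift f O n).
  by apply: measurable_sum => i; exact: measurable_funB.
apply: measurable_funB; last apply: measurable_funX.
  apply: measurable_funM => //; apply: measurable_sum => n.
  exact: measurable_funX.
by apply: measurable_funM => //; exact: measurable_sum.
Qed.

(** At a fixed [x] the time average is a single number, so this is [sum_sqrB] for the sequence of
    drifts at [x]. *)
Lemma drift_variance_birkhoff_sum (R : realType) (d : measure_display)
    (M : measurableType d) (f : M -> M)
    (O : M -> R) (N : nat) (x : M) :
  let S n := birkhoff_sum f (fun y => O y - time_average f O x) n x in
  drift_variance f O N x = (2 * N.+1%:R ^+ 2)^-1 *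
    \sum_(i < N.+1) \sum_(j < N.+1) (S i.+1 - S j.+1) ^+ 2.
Proof.
move=> S; rewrite /drift_variance !big_mkord -/(S _).
rewrite (sum_sqrB (fun i => S i.+1)) /drift -/(S _).
by field; rewrite nat1r.
Qed.

Theorem proposition4 (R : realType) (d : measure_display) (M : measurableType d)
    (f : M -> M) (mu : probability M R) (O : M -> R)
    (f_meas : measurable_fun [set: M] f)
    (mu_natural : natural_measure f mu)
    (mu_ergodic : ergodic f mu)
    (O_L2 : O \in Lfun mu 2%:E)
    (N : nat) :
  (\int[mu]_(x in [set: M]) (drift_variance f O N x)%:E)%E =
  (\sum_(r <- symmetric_range N)
     ((N%:Z - `|r|) * (N%:Z + 1 - `|r|) * (N%:Z + 2 - `|r|))%:~R
       / (6 * N.+1%:R ^+ 2) * autocorrelation f mu r O)%:E.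
Proof.
have f_inv := natural_measure_invariant f_meas mu_natural.
have iO : mu.-integrable setT (EFin \o O).
  by apply/Lfun1_integrable; apply: Lfun_subset12 O_L2; rewrite fin_num_measure.
have mO : measurable_fun setT O by case/integrableP : iO => /measurable_EFinP.
pose m := Rintegral mu setT O.
pose S n := birkhoff_sum f (fun y => O y - m) n.
pose c r := correlation f mu r O O.
pose Q x := \sum_(i < N.+1) \sum_(j < N.+1) (S i.+1 x - S j.+1 x) ^+ 2.
pose G x := (2 * N.+1%:R ^+ 2)^-1 * Q x.
have row (i : 'I_N.+1) := Rintegral_sum (index_enum 'I_N.+1)
  (fun j : 'I_N.+1 => (Rintegral_birkhoff_sumB_sqr f_meas f_inv O_L2 i.+1 j.+1).1).
have [iQ IQ] := Rintegral_sum (index_enum 'I_N.+1) (fun i => (row i).1).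
have iG : mu.-integrable setT (EFin \o G) by exact: integrableZl iQ.
have IG : Rintegral mu setT G = (2 * N.+1%:R ^+ 2)^-1 *
    toeplitz_sum (toeplitz_sum c) N.+1.
  (* The lengths [i.+1] and [j.+1] have the same gap as [i] and [j], so the integrals assemble into
     the outer Toeplitz sum. *)
  rewrite (RintegralZl _ measurableT iQ) IQ; congr (_ * _).
  apply: eq_bigr => i _; rewrite (row i).2; apply: eq_bigr => j _.
  by rewrite (Rintegral_birkhoff_sumB_sqr f_meas f_inv O_L2 i.+1 j.+1).2 !subSS.
(* [G] centres by the constant [m] instead of the time average. The two integrands agree wherever
   the Birkhoff averages converge to [m], hence almost everywhere; both must be measurable for their
   integrals to be identified. *)
transitivity (\int[mu]_x (EFin \o G) x)%E.
  apply: ae_eq_integral => //.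
  - exact/measurable_EFinP/measurable_drift_variance.
  - by case/integrableP : iG.
  apply: filterS (birkhoff_ergodic f_meas f_inv mu_ergodic iO) => x Ox _.
  congr EFin; rewrite drift_variance_birkhoff_sum.
  by rewrite (_ : time_average f O x = m)//; exact/cvg_lim.
rewrite -[LHS]fineK ?integrable_fin_num//; congr EFin.
rewrite -/(Rintegral mu setT G) IG.
pose h k := ((N%:R - k%:R) * (N%:R + 1 - k%:R) * (N%:R + 2 - k%:R)) * c k : R.
(* The 6 is the 2 from the pairwise form of the variance times the 3 from [toeplitz_sum_cube]. *)
transitivity ((6 * N.+1%:R ^+ 2)^-1 * \sum_(r <- symmetric_range N) h `|r|%N).
  rewrite sum_symmetric_range.
  under eq_bigr do rewrite mulrA.
  rewrite toeplitz_sum_cube.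
  by field; rewrite nat1r.
rewrite mulr_sumr; apply: eq_bigr => r _.
rewrite /h /autocorrelation -/(c _) -abszE.
rewrite !rmorphM !rmorphB !rmorphD/=.
by rewrite mulrCA mulrA.
Qed.
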